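(* Let $m\ge 2$ be even and $l\ge 1$, and let $P_m^*$ be the directed path with vertices $0,1,\ldots,m-1$ and arcs $(0,1),(1,2),\ldots,(m-2,m-1)$. Define subsets of $\mathbb{Z}_{(m-1)l^2+1}$ by $A_i=\{il^2/2+jl : 0\le j\le l-1\}$ for $i$ even and $A_i=\{(m-\tfrac{i+1}{2})l^2-j : 0\le j\le l-1\}$ for $i$ odd ($0\le i\le m-1$). Then $(A_0,\ldots,A_{m-1})$ is an $((m-1)l^2+1,m,l,1;P_m^* )$-EDF in $\mathbb{Z}_{(m-1)l^2+1}$.
   Context: $\Delta(A,B)=\{a-b:a\in A,b\in B\}$ (multiset). For a group $\Gamma$ of order $N$ and a digraph $H$ on vertices $\{0,\ldots,m-1\}$, a family $(A_0,\ldots,A_{m-1})$ of pairwise disjoint $l$-subsets of $\Gamma$ is an $(N,m,l,\lambda;H)$-EDF if $\bigcup_{(i,j)\in\overrightarrow{E}(H)}\Delta(A_j,A_i)=\lambda(\Gamma\setminus\{0\})$ as multisets. *)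

(* Defs.v *)
From HB Require Import structures.
From mathcomp Require Import all_boot all_order all_algebra all_fingroup.

Set Implicit Arguments.
Unset Strict Implicit.
Unset Printing Implicit Defensive.

Import GRing.Theory.

(* Finite multisets are represented by sequences up to [perm_eq].             *)

(* The group is not assumed abelian; [a * b^-1] is the difference [a - b] of  *)
(* the additive notation, and on ['Z_n] it is convertible to the ring         *)
(* subtraction.                                                               *)
Definition Delta (gT : finGroupType) (A B : {set gT}) : seq gT :=
  [seq (a * b^-1)%g | a <- enum A, b <- enum B].

(* A digraph on {0, ..., m-1} is given by its set of arcs.                    *)
Definition digraph (m : nat) := {set 'I_m * 'I_m}.

Definition arcDiffs (gT : finGroupType) (m : nat) (H : digraph m)
    (A : 'I_m -> {set gT}) : seq gT :=
  flatten [seq Delta (A e.2) (A e.1) | e <- enum H].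

Definition is_EDF (gT : finGroupType) (N m l lambda : nat) (H : digraph m)
    (A : 'I_m -> {set gT}) : Prop :=
  [/\ #|gT| = N,
      forall i, #|A i| = l,
      forall i j, i != j -> [disjoint A i & A j]
    & perm_eq (arcDiffs H A) (flatten (nseq lambda (enum [set~ (1%g : gT)])))].
Arguments is_EDF {gT} N m l lambda H A.

Definition dipath (m : nat) : digraph m :=
  [set e : 'I_m * 'I_m | e.2 == e.1.+1 :> nat].

Definition pathOrder (m l : nat) : nat := (m - 1) * l ^ 2 + 1.

(* For odd [i] the formula is evaluated in the ring ['Z_N], so that no        *)
(* truncated subtraction occurs; the halvings are exact by the parity of [i]. *)
Definition pathFamily (m l : nat) (i : 'I_m) : {set 'Z_(pathOrder m l)} :=
  if odd i
  then [set ((m%:R - (i.+1)./2%:R) * l%:R ^+ 2 - j%:R)%R | j : 'I_l]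
  else [set ((i * l ^ 2)./2 + j * l)%:R%R | j : 'I_l].
Arguments pathFamily m l i : clear implicits.

(* Main.v *)
Require Import Defs.
From mathcomp Require Import all_boot all_order all_algebra all_fingroup.
From mathcomp Require Import zify.

Set Implicit Arguments.
Unset Strict Implicit.
Unset Printing Implicit Defensive.

Import GRing.Theory.

(** The blocks [A_i] lift to disjoint subsets of [0, (m-1) l^2]: the even ones
    lie in [0, (m/2) l^2 - l], the odd ones in [(m/2) l^2 - l + 1, (m-1) l^2].
    Cut [1, (m-1) l^2] into [m - 1] intervals of length [l^2].  The differences
    along the arc [(i, i+1)] sweep the interval [m - 2 - i] if [i] is even and,
    after adding the group order, the interval [i] if [i] is odd; as [m] is
    even, every nonzero element is reached.  There are only [(m-1) l^2]
    differences in all, so each is reached exactly once. *)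

(** Natural-number representative of the [j]-th element of the block [A_i]. For [0 < l], [i < m] and
    [j < l] no subtraction truncates: [i.+1./2 < m] when [i] is odd, and [j < l <= l ^ 2]. *)
Definition pathElt (m l i j : nat) : nat :=
  if odd i then (m - (i.+1)./2) * l ^ 2 - j else i./2 * l ^ 2 + j * l.

Lemma eqn_divmod d q r q' r' : r < d -> r' < d ->
  q * d + r = q' * d + r' -> q = q' /\ r = r'.
Proof.
move=> rd rd' e; have d0 : 0 < d by apply: leq_ltn_trans rd.
split.
  by move/(congr1 (divn^~ d)): e; rewrite /= !divnMDl // !divn_small // !addn0.
by move/(congr1 (modn^~ d)): e; rewrite /= !modnMDl !modn_small.
Qed.

Lemma ZpR_eq n a b : 1 < n ->
  a%:R%R = b%:R%R :> 'Z_n <-> a = b %[mod n].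
Proof.
move=> n1; split=> [/(congr1 val)|e]; first by rewrite /= !val_Zp_nat.
by apply: val_inj; rewrite /= !val_Zp_nat.
Qed.

(** An arc is determined by its head, and a head is never the vertex 0, so it lies in the image of
    [lift ord0]. *)
Lemma card_dipath m : #|dipath m| <= m.-1.
Proof.
rewrite -[X in _ <= X]card_ord.
case: m => [|n]; first by apply: leq_trans (max_card _) _; rewrite card_prod !card_ord.
rewrite /= -(card_imset _ (@lift_inj n.+1 ord0)) -(card_in_imset (f := snd)).
  apply: subset_leq_card; apply/subsetP => i /imsetP[e].
  rewrite inE => /eqP ee ->; apply/imsetP.
  have h : e.1 < n by rewrite -ltnS -ee.
  by exists (Ordinal h) => //; apply: val_inj; rewrite /= ee.
move=> [i j] [i' j']; rewrite !inE /= => /eqP e1 /eqP e2 ejj.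
by rewrite ejj in e1 *; congr pair; apply: val_inj; move: e1; rewrite e2 => -[].
Qed.

Section PathElt.

Variables (m l : nat).
Hypotheses (m_gt1 : 1 < m) (m_even : ~~ odd m) (l_gt0 : 0 < l).

Lemma pathOrder_gt1 : 1 < pathOrder m l.
Proof. by rewrite /pathOrder addn1 ltnS muln_gt0 expn_gt0 l_gt0 subn_gt0 m_gt1. Qed.

Lemma leq_l_sqr : l <= l ^ 2.
Proof. by rewrite expnS expn1 leq_pmulr. Qed.

(** The extreme case is [i = m - 2], [j = l - 1], where equality holds. *)
Lemma pathElt_even_lt i j : i < m -> j < l -> ~~ odd i ->
  pathElt m l i j + l <= m./2 * l ^ 2.
Proof.
move=> im jl /negbTE io; rewrite /pathElt io -addnA -mulSnr.
have h : i./2 < m./2 by move: im m_even io; lia.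
apply: leq_trans (leq_mul h (leqnn _)).
by rewrite [X in _ <= X]mulSnr leq_add2l expnS expn1 leq_mul2r jl orbT.
Qed.

(** The extreme case is [i = m - 1], [j = l - 1], one above the largest even value. *)
Lemma pathElt_odd_gt i j : i < m -> j < l -> odd i ->
  m./2 * l ^ 2 < pathElt m l i j + l.
Proof.
move=> im jl io; rewrite /pathElt io.
have h : m./2 <= m - i.+1./2 by move: im m_even io; lia.
have := leq_mul h (leqnn (l ^ 2)); lia.
Qed.

Lemma pathElt_lt i j : i < m -> j < l -> pathElt m l i j < pathOrder m l.
Proof.
move=> im jl; rewrite /pathOrder addn1 ltnS.
have [io|io] := boolP (odd i).
  rewrite /pathElt io; apply: leq_trans (leq_subr _ _) _.
  by rewrite leq_mul2r; apply/orP; right; move: io; lia.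
apply: leq_trans (leq_addr l _) _; apply: leq_trans (pathElt_even_lt im jl io) _.
by rewrite leq_mul2r; apply/orP; right; move: m_even m_gt1; lia.
Qed.

Lemma pathElt_inj i j i' j' : i < m -> j < l -> i' < m -> j' < l ->
  pathElt m l i j = pathElt m l i' j' -> i = i' /\ j = j'.
Proof.
move=> im jl im' jl'.
have [io|io] := boolP (odd i); have [io'|io'] := boolP (odd i'); last first.
- rewrite /pathElt (negbTE io) (negbTE io') => e.
  (* Both values are multiples of [l]; dividing by [l] leaves base-[l] expansions with last digits
     [j] and [j']. *)
  have /(eqn_divmod jl jl')[] : i./2 * l + j = i'./2 * l + j'.
    by apply/eqP; rewrite -(eqn_pmul2r l_gt0) !mulnDl -!mulnA mulnn e.
  by move: io io'; lia.
- move=> e; have := pathElt_even_lt im jl io.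
  by rewrite e leqNgt (pathElt_odd_gt im' jl' io').
- move=> e; have := pathElt_even_lt im' jl' io'.
  by rewrite -e leqNgt (pathElt_odd_gt im jl io).
rewrite /pathElt io io' => e.
have h k : k < m -> odd k -> l <= (m - k.+1./2) * l ^ 2.
  move=> km ko; apply: leq_trans leq_l_sqr _; rewrite leq_pmull //; lia.
have hi := h i im io; have hi' := h i' im' io'.
(* Moving the subtracted [j] and [j'] across turns the equation into two base-[l ^ 2] expansions. *)
have /eqn_divmod[] : (m - i.+1./2) * l ^ 2 + j' = (m - i'.+1./2) * l ^ 2 + j.
- lia.
- exact: leq_trans jl' leq_l_sqr.
- exact: leq_trans jl leq_l_sqr.
by move: im im' io io'; lia.
Qed.

Lemma pathElt_diff_cover x : 0 < x < pathOrder m l ->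
  exists i j j', [/\ i.+1 < m, j < l, j' < l &
    pathElt m l i.+1 j = x + pathElt m l i j' %[mod pathOrder m l]].
Proof.
move=> /andP[x0 xN]; have L0 : 0 < l ^ 2 by rewrite expn_gt0 l_gt0.
(* The intervals start at 1, hence the predecessor: [b] is the index of the interval containing [x],
   and [r] the offset in it. *)
pose b := x.-1 %/ l ^ 2; pose r := x.-1 %% l ^ 2.
have rL : r < l ^ 2 by rewrite ltn_mod.
have ex : x = b * l ^ 2 + r + 1 by rewrite -divn_eq addn1 prednK.
have bm : b < m - 1.
  by rewrite ltn_divLR // -ltnS prednK //; move: xN; rewrite /pathOrder addn1.
have digits s : s < l ^ 2 -> [/\ s %% l < l, s %/ l < l & s = s %/ l * l + s %% l].
  by move=> sL; split; [rewrite ltn_mod | rewrite ltn_divLR // mulnn | apply: divn_eq].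
have [bo|/negbTE bo] := boolP (odd b).
  have [jl jl' er] := digits r rL.
  (* With the group order added, the difference along [(b, b+1)] is [b * l ^ 2 + (j * l + j') + 1],
     so [j] and [j'] are the base-[l] digits of [r]. *)
  exists b, (r %/ l), (r %% l); split=> //; first by lia.
  rewrite -(modnDr (pathElt _ _ _ _)); congr (_ %% _).
  rewrite /pathElt /= bo /= /pathOrder ex.
  move: (r %/ l) (r %% l) jl jl' er => q t jl jl' er.
  have [k ek] : exists k, b = k.*2.+1 by exists b./2; move: bo; lia.
  rewrite ek /= doubleK.
  have [c ec] : exists c, m = k.+1 + c.+1 by exists (m - k.+2); lia.
  rewrite ec addKn addnS subn1 /=.
  have := leq_l_sqr; rewrite er; move: (l ^ 2) => L lL.
  have : t <= c.+1 * L by rewrite mulSn; lia.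
  rewrite -addnn; nia.
(* For [i = m - 2 - b], which is even, the difference is [(b + 1) * l ^ 2 - (j' * l + j)]. It
   decreases in the digits, so they are those of the complement [s] of [r]. *)
pose s := l ^ 2 - 1 - r; have sL : s < l ^ 2 by rewrite /s; lia.
have [jl jl' es] := digits s sL.
exists (m - 2 - b), (s %% l), (s %/ l); split=> //; first by lia.
congr (_ %% _).
have io : odd (m - 2 - b) = false by move: m_even bo bm; lia.
rewrite /pathElt /= io /= ex.
have er : r + 1 + s = l ^ 2 by rewrite /s; lia.
move: s (s %/ l) (s %% l) jl jl' es er {sL io} => s q t jl jl' es er.
have [k ek] : exists k, m = b + 2 + k.*2.
  by exists (m - 2 - b)./2; move: m_even bo bm; lia.
have -> : m - 2 - b = k.*2 by lia.
rewrite /= doubleK.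
have -> : m - k.+1 = b + 1 + k by lia.
rewrite !mulnDl mul1n; lia.
Qed.

Lemma pathFamilyE (i : 'I_m) :
  pathFamily m l i = [set (pathElt m l i j)%:R%R | j : 'I_l].
Proof.
rewrite /pathFamily /pathElt; have im := ltn_ord i.
case: ifP => io; apply: eq_imset => j; last first.
  by congr (_ + _)%:R%R; rewrite -{1}[nat_of_ord i]odd_double_half io add0n -doubleMl doubleK.
have jl := ltn_ord j.
have h : j <= (m - i.+1./2) * l ^ 2.
  apply: leq_trans (ltnW jl) (leq_trans leq_l_sqr _).
  by rewrite leq_pmull //; move: io; lia.
by rewrite natrB // natrM natrX natrB //; move: io; lia.
Qed.

Lemma pathElt_Zp_inj i j i' j' : i < m -> j < l -> i' < m -> j' < l ->
  (pathElt m l i j)%:R%R = (pathElt m l i' j')%:R%R :> 'Z_(pathOrder m l) ->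
  i = i' /\ j = j'.
Proof.
move=> im jl im' jl' /(ZpR_eq _ _ pathOrder_gt1).
by rewrite !modn_small ?pathElt_lt //; apply: pathElt_inj.
Qed.

Lemma card_pathFamily (i : 'I_m) : #|pathFamily m l i| = l.
Proof.
rewrite pathFamilyE card_imset ?card_ord // => j j' e.
by apply: val_inj; have [] := pathElt_Zp_inj (ltn_ord i) (ltn_ord j) (ltn_ord i) (ltn_ord j') e.
Qed.

Lemma pathFamily_disjoint (i i' : 'I_m) :
  i != i' -> [disjoint pathFamily m l i & pathFamily m l i'].
Proof.
apply: contraNT => /pred0Pn[x /=]; rewrite !pathFamilyE.
case/andP => /imsetP[j _ ->] /imsetP[j' _ e]; apply/eqP/val_inj.
by have [] := pathElt_Zp_inj (ltn_ord i) (ltn_ord j) (ltn_ord i') (ltn_ord j') e.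
Qed.

Lemma size_arcDiffs_dipath :
  size (arcDiffs (dipath m) (pathFamily m l)) <= (m - 1) * l ^ 2.
Proof.
rewrite /arcDiffs size_flatten /shape -map_comp.
rewrite (eq_map (g := fun=> l ^ 2)); last first.
  by move=> e; rewrite /= size_allpairs -!cardE !card_pathFamily mulnn.
rewrite sumnE big_map big_const_seq count_predT -cardE iter_addn_0 mulnC.
by rewrite leq_mul2r subn1 card_dipath orbT.
Qed.

Lemma arcDiffs_dipath_cover (x : 'Z_(pathOrder m l)) :
  x != 1%g -> x \in arcDiffs (dipath m) (pathFamily m l).
Proof.
move=> x1; have xb : 0 < x < pathOrder m l.
  have -> : x < pathOrder m l.
    by apply: leq_trans (ltn_ord x) _; rewrite Zp_cast // pathOrder_gt1.
  rewrite andbT lt0n.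
  (* The unit [1%g] of the additive group is the residue 0. *)
  by apply: contraNneq x1 => x0; apply/eqP/val_inj.
have [i [j [j' [im jl jl' e]]]] := pathElt_diff_cover xb.
have ex : x = ((pathElt m l i.+1 j)%:R - (pathElt m l i j')%:R)%R.
  by apply/eqP; rewrite eq_sym subr_eq -{1}(natr_Zp x) -natrD; apply/eqP; apply/(ZpR_eq _ _ pathOrder_gt1).
apply/flatten_mapP; exists (Ordinal (ltnW im), Ordinal im).
  by rewrite mem_enum inE.
apply/allpairsP; exists ((pathElt m l i.+1 j)%:R, (pathElt m l i j')%:R)%R.
split=> //=; rewrite mem_enum pathFamilyE; apply/imsetP.
  by exists (Ordinal jl).
by exists (Ordinal jl').
Qed.

End PathElt.

Theorem theorem6p1 (m l : nat) (hm : 2 <= m) (hm_even : ~~ odd m)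
    (hl : 1 <= l) :
  is_EDF ((m - 1) * l ^ 2 + 1) m l 1 (dipath m) (pathFamily m l).
Proof.
have cardZ : #|'Z_(pathOrder m l)| = pathOrder m l.
  by rewrite card_ord Zp_cast // pathOrder_gt1.
split=> //; [exact: card_pathFamily | exact: pathFamily_disjoint |].
rewrite /= cats0 perm_sym; set s := enum _.
have sub : {subset s <= arcDiffs (dipath m) (pathFamily m l)}.
  by move=> x; rewrite mem_enum !inE; apply: arcDiffs_dipath_cover.
have le_size : size (arcDiffs (dipath m) (pathFamily m l)) <= size s.
  apply: leq_trans (size_arcDiffs_dipath hm hm_even hl) _.
  by rewrite -cardE cardsC1 cardZ /pathOrder addn1.
have us : uniq s := enum_uniq _.
(* The duplicate-free list [s] is contained in a list that is no longer than it; hence that list has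
   no repetition either, and the same members. *)
apply: uniq_perm => //; first exact: leq_size_uniq sub le_size.
by have [] := uniq_min_size us sub le_size.
Qed.
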